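(* Let $G$ be a finitely generated group, let $R$ be a commutative $\mathbb{Q}$-algebra, let $Z\in\mathscr{C}(G,R)$ be a class function of $G$ with values in $R$, and let $\Omega_1,\Omega_2$ be two permutation groups of finite degree. Then $$\left(Z\wr\Omega_1\right)\wr\Omega_2 = Z\wr\left(\Omega_1\wr\Omega_2\right),$$ where $Z\wr\Omega$ denotes the orbifold transform of $Z$ by $\Omega$, and $\Omega_1\wr\Omega_2$ is the wreath product in its action on the Cartesian product.
   Context: A commutative $\mathbb{Q}$-algebra is a commutative ring with identity containing an isomorphic copy of the field of rational numbers. For a finitely generated group $G$, $\mathscr{L}(G)$ denotes the set of finite index subgroups of $G$. A class function with values in $R$ is a map $Z:\mathscr{L}(G)\to R$ with $Z(g^{-1}Hg)=Z(H)$ for all $g\in G$, $H\in\mathscr{L}(G)$; the set of these is denoted $\mathscr{C}(G,R)$. A permutation group of finite degree is a subgroup $\Omega<S_X$ of the symmetric group of a finite set $X$; its degree is $|X|$. Permutations act from the left and products are compositions. Orbifold transform: for $Z\in\mathscr{C}(G,R)$ and a permutation group $\Omega<S_X$ of finite degree, $Z\wr\Omega:\mathscr{L}(G)\to R$ is the map $$(Z\wr\Omega)(H)=\frac{1}{|\Omega|}\sum_{\phi:H\to\Omega}\ \prod_{\xi\in\mathcal{O}(\phi)}Z(H_\xi),$$ where the sum runs over all group homomorphisms $\phi:H\to\Omega$, $\mathcal{O}(\phi)$ is the set of orbits of $\phi(H)$ on $X$, and $H_\xi=\{g\in H : \phi(g)\xi^*=\xi^*\}$ for an arbitrarily chosen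 representative $\xi^*\in\xi$ (the value $Z(H_\xi)$ does not depend on this choice, as $Z$ is a class function). The sum is finite, and $Z\wr\Omega$ is again a class function, i.e. $Z\wr\Omega\in\mathscr{C}(G,R)$. Wreath product: for permutation groups $\Omega_1<S_X$ and $\Omega_2<S_Y$ with $X,Y$ finite, and for $\lambda\in\Omega_1^Y$ (a map $Y\to\Omega_1$) and $\omega\in\Omega_2$, let $\lambda\wr\omega$ be the permutation $(x,y)\mapsto(\lambda(y)x,\omega y)$ of $X\times Y$. The permutations $\{\lambda\wr\omega : \lambda\in\Omega_1^Y,\ \omega\in\Omega_2\}$ form a permutation group on $X\times Y$, denoted $\Omega_1\wr\Omega_2$.
   Formalization: The degree of Ω1 is assumed positive (X nonempty); for X empty the identity fails, e.g. for H = Z² and |Ω2| = 2 the left side is |Hom(H,Ω2)|/|Ω2| = 2 and the right side is 1. *)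

(* Defs.v *)
From HB Require Import structures.
From mathcomp Require Import all_boot all_order all_algebra all_fingroup.
From mathcomp Require Import boolp classical_sets functions cardinality fsbigop.

Set Implicit Arguments.
Unset Strict Implicit.
Unset Printing Implicit Defensive.

Import GRing.Theory.

Local Open Scope classical_set_scope.
Local Open Scope group_scope.

(* [groupType] is MathComp's structure of arbitrary, possibly infinite, groups. *)

Definition is_subgroup (G : groupType) (H : set G) : Prop :=
  [/\ H 1, forall x y, H x -> H y -> H (x * y) & forall x, H x -> H x^-1].

Definition left_coset (G : groupType) (H : set G) (g : G) : set G :=
  [set g * h | h in H].

Definition finite_index (G : groupType) (H : set G) : Prop :=
  finite_set (range (left_coset H)).

Definition finitely_generated (G : groupType) : Prop :=
  exists s : seq G, forall K : set G,
    is_subgroup K -> (forall x, x \in s -> K x) -> K = [set: G].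

Record fisubgroup (G : groupType) : Type := FiSubgroup {
  fi_set :> set G;
  fi_subgroup : is_subgroup fi_set;
  fi_index : finite_index fi_set }.

Lemma fisubgroup_ext (G : groupType) (H K : fisubgroup G) :
  (H : set G) = K -> H = K.
Proof.
case: H K => [H hH iH] [K hK iK] /= E; move: hK iK; rewrite -E => hK iK.
by rewrite (Prop_irrelevance hK hH) (Prop_irrelevance iK iH).
Qed.

Definition conj_set (G : groupType) (H : set G) (g : G) : set G :=
  [set h ^ g | h in H].

Lemma conj_setE (G : groupType) (H : set G) (g x : G) :
  conj_set H g x = H (x ^ g^-1).
Proof.
apply/propext; split; first by case=> h Hh <-; rewrite conjgK.
by move=> Hx; exists (x ^ g^-1) => //; rewrite conjgKV.
Qed.

Lemma conj_subgroup (G : groupType) (H : fisubgroup G) (g : G) :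
  is_subgroup (conj_set H g).
Proof.
have [H1 HM HV] := fi_subgroup H; split=> [|x y|x]; rewrite !conj_setE.
- by rewrite conj1g.
- by rewrite conjMg; apply: HM.
- by rewrite conjVg; apply: HV.
Qed.

Lemma conj_index (G : groupType) (H : fisubgroup G) (g : G) :
  finite_index (conj_set H g).
Proof.
apply: (@sub_finite_set _ _
  ((fun C : set G => [set c ^ g | c in C]) @` range (left_coset H))); last first.
  exact/finite_image/fi_index.
move=> _ [x _ <-]; exists (left_coset H (x ^ g^-1)); first by exists (x ^ g^-1).
apply/seteqP; split=> y /=.
- case=> _ [h Hh <-] <-; exists (h ^ g); first by exists h.
  by rewrite conjMg conjgKV.
- case=> _ [h Hh <-] <-; exists (x ^ g^-1 * h); first by exists h.
  by rewrite conjMg conjgKV.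
Qed.

Definition fi_conj (G : groupType) (H : fisubgroup G) (g : G) : fisubgroup G :=
  FiSubgroup (conj_subgroup H g) (conj_index H g).

Record class_function (G : groupType) (R : Type) : Type := ClassFunction {
  cf_val :> fisubgroup G -> R;
  cf_conj : forall (g : G) (H : fisubgroup G), cf_val (fi_conj H g) = cf_val H }.

Lemma class_function_ext (G : groupType) (R : Type) (Z1 Z2 : class_function G R) :
  Z1 =1 Z2 -> Z1 = Z2.
Proof.
case: Z1 Z2 => [Z1 c1] [Z2 c2] /= /funext E; move: c2; rewrite -E => c2.
by rewrite (Prop_irrelevance c2 c1).
Qed.

(* A homomorphism H -> Omega is encoded as a total function on G sent to the  *)
(* junk value 1 outside H, so that it is determined by its values on H.       *)
(* Permutations act from the left and compose as functions, whereas the       *)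
(* product of {perm X} is (s * t) x = t (s x); hence the pointwise [hom_mul]. *)
Record perm_hom (G : groupType) (H : fisubgroup G) (X : finType)
    (Omega : {group {perm X}}) : Type := PermHom {
  hom_fun :> G -> {perm X};
  hom_in : forall g, fi_set H g -> hom_fun g \in Omega;
  hom_mul : forall g h, fi_set H g -> fi_set H h ->
    forall x, hom_fun (g * h) x = hom_fun g (hom_fun h x);
  hom_out : forall g, ~ fi_set H g -> hom_fun g = 1 }.

HB.instance Definition _ (G : groupType) (H : fisubgroup G) (X : finType)
  (Omega : {group {perm X}}) := gen_eqMixin (perm_hom H Omega).
HB.instance Definition _ (G : groupType) (H : fisubgroup G) (X : finType)
  (Omega : {group {perm X}}) := gen_choiceMixin (perm_hom H Omega).

Section HomTheory.
Variables (G : groupType) (H : fisubgroup G) (X : finType).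
Variables (Omega : {group {perm X}}).
Implicit Types phi psi : perm_hom H Omega.

Lemma hom_ext phi psi : phi =1 psi -> phi = psi.
Proof.
case: phi psi => [f i m o] [f' i' m' o'] /= /funext E.
move: i' m' o'; rewrite -E => i' m' o'.
by rewrite (Prop_irrelevance i' i) (Prop_irrelevance m' m)
  (Prop_irrelevance o' o).
Qed.

Lemma hom1 phi x : phi 1 x = x.
Proof.
have [H1 _ _] := fi_subgroup H.
by apply: (@perm_inj _ (phi 1)); rewrite -(hom_mul phi) // mulg1.
Qed.

Lemma homV phi g x : fi_set H g -> phi g (phi g^-1 x) = x.
Proof.
move=> Hg; have [_ _ HV] := fi_subgroup H.
by rewrite -(hom_mul phi) ?mulgV ?hom1 //; apply: HV.
Qed.

Lemma homVK phi g x : fi_set H g -> phi g^-1 (phi g x) = x.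
Proof.
move=> Hg; have [_ _ HV] := fi_subgroup H.
by rewrite -(hom_mul phi) ?mulVg ?hom1 //; apply: HV.
Qed.

Definition stab_set phi (x : X) : set G := [set g | fi_set H g /\ phi g x = x].

Lemma stab_subgroup phi x : is_subgroup (stab_set phi x).
Proof.
have [H1 HM HV] := fi_subgroup H; split=> [|g h [Hg xg] [Hh xh]|g [Hg xg]].
- by split=> //; rewrite hom1.
- by split; [apply: HM | rewrite hom_mul // xh xg].
- by split; [apply: HV | rewrite -{1}xg homVK].
Qed.

Lemma stab_index phi x : finite_index (stab_set phi x).
Proof.
have [H1 HM HV] := fi_subgroup H.
pose r (C : set G) : G := xget 1 C.
pose F (p : set G * X) : set G :=
  [set g | exists h, [/\ fi_set H h, phi h x = p.2 & g = r p.1 * h]].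
apply: (@sub_finite_set _ _ (F @` (range (left_coset H) `*` [set: X]))).
  move=> _ [g _ <-]; set C := left_coset H g.
  have [h Hh Cr] : C (r C) by apply: xgetPex; exists g; exists 1; rewrite ?mulg1.
  exists (C, phi h^-1 x); first by split=> //; exists g.
  apply/seteqP; split=> y /=.
  - case=> k [Hk phik ->]; exists (h * k); last by rewrite -Cr mulgA.
    by split; [exact: HM | rewrite hom_mul // phik homV].
  - case=> k [Hk xk] <-; exists (h^-1 * k).
    have HVh := HV _ Hh.
    split; [exact: HM | by rewrite hom_mul // xk | ].
    by rewrite -Cr -mulgA mulKVg.
by apply/finite_image/finite_setX; [exact: fi_index | exact: finite_finset].
Qed.

Definition stab phi (x : X) : fisubgroup G :=
  FiSubgroup (stab_subgroup phi x) (stab_index phi x).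

Definition hom_image phi : {set {perm X}} :=
  [set s | `[< exists2 g, fi_set H g & phi g = s >]]%SET.

Definition hom_orbits phi : {set {set X}} :=
  (orbit 'P (hom_image phi) @: [set: X])%SET.

(* The orbit representative is the one chosen by [pick]; the default branch   *)
(* is unreachable, as the members of [hom_orbits phi] are nonempty.           *)
Definition orbit_value (R : pzRingType) (Z : fisubgroup G -> R) phi
    (xi : {set X}) : R :=
  if [pick x in xi] is Some x then Z (stab phi x) else 1%R.

End HomTheory.

(* [\sum_(phi \in _)] is the sum of a finitely supported family; for finitely *)
(* generated G there are only finitely many homomorphisms H -> Omega.         *)
Definition orbifold_fun (G : groupType) (R : comAlgType rat)
    (Z : fisubgroup G -> R) (X : finType) (Omega : {group {perm X}})
    (H : fisubgroup G) : R :=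
  ((#|Omega|%:R^-1 : rat) *:
    \sum_(phi \in [set: perm_hom H Omega])
      \prod_(xi in hom_orbits phi) orbit_value Z phi xi)%R.

Section OrbifoldConj.
Variables (G : groupType) (X : finType) (Omega : {group {perm X}}).
Variables (H : fisubgroup G) (g : G).

Let pull_fun (phi : perm_hom H Omega) (x : G) : {perm X} := phi (x ^ g^-1).

Let pull (phi : perm_hom H Omega) : perm_hom (fi_conj H g) Omega.
Proof.
apply: (@PermHom _ _ _ _ (pull_fun phi)) => [x|x y|x] /=; rewrite /pull_fun ?conj_setE.
- exact: hom_in.
- by rewrite conjMg => Hx Hy z; rewrite hom_mul.
- exact: hom_out.
Defined.

Let push_fun (phi : perm_hom (fi_conj H g) Omega) (x : G) : {perm X} := phi (x ^ g).

Let conjE x : fi_set (fi_conj H g) (x ^ g) = fi_set H x.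
Proof. by rewrite /= conj_setE conjgK. Qed.

Let push (phi : perm_hom (fi_conj H g) Omega) : perm_hom H Omega.
Proof.
apply: (@PermHom _ _ _ _ (push_fun phi)) => [x|x y|x]; rewrite /push_fun -?conjE.
- exact: hom_in.
- by rewrite conjMg => Hx Hy z; rewrite hom_mul.
- exact: hom_out.
Defined.

Let pull_bij : bijective pull.
Proof.
exists push => phi; apply: hom_ext => x /=.
  by rewrite /push_fun /= /pull_fun conjgK.
by rewrite /pull_fun /= /push_fun conjgKV.
Qed.

Lemma orbifold_fun_conj (R : comAlgType rat) (Z : class_function G R) :
  orbifold_fun Z Omega (fi_conj H g) = orbifold_fun Z Omega H.
Proof.
rewrite /orbifold_fun; congr (_ *: _)%R.
rewrite (@reindex_fsbigT _ _ _ (perm_hom H Omega) _ pull _ pull_bij).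
apply: eq_fsbigr => phi _.
have -> : hom_orbits (pull phi) = hom_orbits phi.
  rewrite /hom_orbits; suff -> : hom_image (pull phi) = hom_image phi by [].
  apply/setP => s; rewrite !inE; apply/asboolP/asboolP => -[x Hx <-].
    by exists (x ^ g^-1) => //; move: Hx; rewrite /= conj_setE.
  by exists (x ^ g); [rewrite conjE | rewrite /= /pull_fun conjgK].
apply: eq_bigr => xi _; rewrite /orbit_value; case: pickP => // x _.
rewrite -(cf_conj Z g (stab phi x)); congr (Z _).
apply: fisubgroup_ext => /=; apply/funext => y.
by rewrite conj_setE /stab_set /= conj_setE.
Qed.

End OrbifoldConj.

Definition orbifold (G : groupType) (R : comAlgType rat) (Z : class_function G R)
    (X : finType) (Omega : {group {perm X}}) : class_function G R :=
  @ClassFunction G R (orbifold_fun Z Omega)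
    (fun g H => orbifold_fun_conj Omega H g Z).

Section Wreath.
Variables (X Y : finType).

Definition wreath_fun (l : {ffun Y -> {perm X}}) (w : {perm Y}) (p : X * Y) :
  X * Y := (l p.2 p.1, w p.2).

Lemma wreath_fun_inj l w : injective (wreath_fun l w).
Proof. by move=> [x y] [x' y'] [] /[swap] /perm_inj -> /perm_inj ->. Qed.

Definition wreath_perm l w : {perm X * Y} := perm (@wreath_fun_inj l w).

Definition wreath_set (Omega1 : {set {perm X}}) (Omega2 : {set {perm Y}}) :
  {set {perm X * Y}} :=
  [set wreath_perm l w | l in ffun_on (mem Omega1), w in Omega2]%SET.

Lemma wreath_group_set (Omega1 : {group {perm X}}) (Omega2 : {group {perm Y}}) :
  group_set (wreath_set Omega1 Omega2).
Proof.
apply/group_setP; split.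
  apply/imset2P; exists [ffun=> 1] 1; rewrite ?group1 //.
    by apply/ffun_onP => y; rewrite ffunE; apply: group1.
  by apply/permP => -[x y]; rewrite perm1 permE /wreath_fun /= ffunE !perm1.
move=> _ _ /imset2P[l w /ffun_onP lO wO ->] /imset2P[l' w' /ffun_onP lO' wO' ->].
apply/imset2P; exists [ffun y => l y * l' (w y)] (w * w'); rewrite ?groupM //.
  by apply/ffun_onP => y; rewrite ffunE; apply: groupM; [exact: lO | exact: lO'].
by apply/permP => -[x y]; rewrite permM !permE /wreath_fun /= ffunE !permM.
Qed.

Definition wreath (Omega1 : {group {perm X}}) (Omega2 : {group {perm Y}}) :
  {group {perm X * Y}} := Group (wreath_group_set Omega1 Omega2).

End Wreath.

(* Main.v *)
(* A homomorphism Phi : H -> Omega1 wr Omega2 projects to a homomorphism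
   psi : H -> Omega2. Choose representatives v i of the psi-orbits on Y and
   elements t y of H carrying the representative of the orbit of y to y, with
   t (v i) = 1. The homomorphisms Phi over a fixed psi then correspond to pairs
   (phi, mu), where phi_i : stab (v i) -> Omega1 is an arbitrary homomorphism
   and mu : Y -> Omega1 is an arbitrary map that is trivial at every v i; hence
   each family phi comes from |Omega1| ^ (|Y| - number of psi-orbits)
   homomorphisms Phi. If w i represents the phi_i-orbits on X, the points
   (w i j, v i) represent the Phi-orbits on X x Y, and the stabilizer of
   (x, v i) under Phi equals the stabilizer of x under phi_i. So the product
   over the Phi-orbits factors over i, and distributing the product over the
   sum turns the sum over Phi into the product of the inner transforms; the
   powers of |Omega1| match because
   |Omega1 wr Omega2| = |Omega1| ^ |Y| * |Omega2|. *)
From HB Require Import structures.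
Require Import Defs.
From mathcomp Require Import all_boot all_order all_algebra all_fingroup.
From mathcomp Require Import finmap boolp classical_sets functions cardinality fsbigop.

Set Implicit Arguments.
Unset Strict Implicit.
Unset Printing Implicit Defensive.

Import GRing.Theory Num.Theory.

Local Open Scope classical_set_scope.
Local Open Scope group_scope.

(** * Finiteness of the set of homomorphisms into a finite permutation group *)

Section FiniteHoms.
Variables (G : groupType) (H : fisubgroup G).

(** Representing [H] itself by 1 gives [schreier g 1 = g] for [g] in [H], so agreement on Schreier
    elements can be read back as agreement on [H]. *)
Let coset_repr (C : set G) : G := if `[< C 1 >] then 1 else xget 1 C.
Let repr_of (g : G) : G := coset_repr (left_coset H g).

Let fi1 : fi_set H 1. Proof. by case: (fi_subgroup H). Qed.
Let fiM x y : fi_set H x -> fi_set H y -> fi_set H (x * y).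
Proof. by case: (fi_subgroup H) => _ + _; apply. Qed.
Let fiV x : fi_set H x -> fi_set H x^-1.
Proof. by case: (fi_subgroup H) => _ _; apply. Qed.

Let left_cosetE g x : left_coset H g x = fi_set H (g^-1 * x).
Proof.
apply/propext; split; first by case=> h Hh <-; rewrite mulKg.
by move=> Hx; exists (g^-1 * x); rewrite ?mulKVg.
Qed.

Let repr_ofP g : fi_set H (g^-1 * repr_of g).
Proof.
rewrite -left_cosetE /repr_of /coset_repr; case: asboolP => // _.
by apply: xgetPex; exists g; rewrite left_cosetE mulVg.
Qed.

Let repr_of_eq g h : fi_set H (g^-1 * h) -> repr_of g = repr_of h.
Proof.
move=> Hgh; rewrite /repr_of; congr coset_repr.
apply/funext => x; rewrite !left_cosetE; apply/propext; split => Hx.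
  by have := fiM (fiV Hgh) Hx; rewrite invgM invgK -!mulgA mulKVg.
by have := fiM Hgh Hx; rewrite -!mulgA mulKVg.
Qed.

Let repr_of1 h : fi_set H h -> repr_of h = 1.
Proof.
move=> Hh; rewrite /repr_of /coset_repr left_cosetE mulg1.
by rewrite asboolT //; apply: fiV.
Qed.

Let repr_ofK g : repr_of (repr_of g) = repr_of g.
Proof. by symmetry; apply: repr_of_eq; apply: repr_ofP. Qed.

Let repr_ofMr g h : repr_of (g * repr_of h) = repr_of (g * h).
Proof.
symmetry; apply: repr_of_eq.
by rewrite invgM -mulgA mulKg; apply: repr_ofP.
Qed.

Let schreier (g t : G) : G := (repr_of (g * t))^-1 * g * t.

Let schreier_in g t : fi_set H (schreier g t).
Proof. by have := fiV (repr_ofP (g * t)); rewrite invgM invgK mulgA. Qed.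

Let schreierM g h t :
  schreier (g * h) t = schreier g (repr_of (h * t)) * schreier h t.
Proof. by rewrite /schreier repr_ofMr !mulgA mulgK. Qed.

Let schreierV g t :
  schreier g^-1 (repr_of t) = (schreier g (repr_of (g^-1 * t)))^-1.
Proof.
by rewrite /schreier !repr_ofMr mulKVg !invgM !invgK !mulgA.
Qed.

(* Schreier's lemma in disguise: the elements [schreier x (repr_of t)] *)
(* generate H.                                                         *)
Let hom_eq_schreier (X : finType) (Omega : {group {perm X}}) (s : seq G)
    (phi psi : perm_hom H Omega) :
    (forall K : set G,
      is_subgroup K -> (forall x, x \in s -> K x) -> K = [set: G]) ->
    (forall x t, x \in s ->
      phi (schreier x (repr_of t)) = psi (schreier x (repr_of t))) ->
  phi = psi.
Proof.
move=> gen agree.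
(* The cocycle identities [schreierM] and [schreierV] make this set a subgroup, so agreement spreads
   from the generators [s] to all of [G]. *)
pose K := [set g | forall t,
  phi (schreier g (repr_of t)) = psi (schreier g (repr_of t))].
have KE : K = [set: G].
  apply: gen => [|x xs t]; last exact: agree.
  split=> [t|g h Kg Kh t|g Kg t].
  - rewrite /schreier mul1g mulg1 repr_ofK mulVg.
    by apply/permP => x; rewrite !hom1.
  - rewrite schreierM; apply/permP => x.
    have HS y u : fi_set H (schreier y u) by exact: schreier_in.
    by rewrite (hom_mul phi (HS _ _) (HS _ _)) (hom_mul psi (HS _ _) (HS _ _)) Kg Kh.
  - rewrite schreierV; set k := schreier _ _; have Hk : fi_set H k.
      exact: schreier_in.
    apply/permP => x; apply: (@perm_inj _ (phi k)).
    by rewrite homV // /k Kg homV.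
apply: hom_ext => g; have [Hg|nHg] := pselect (fi_set H g); last first.
  by rewrite !hom_out.
have : K g by rewrite KE.
move=> /(_ 1); rewrite (repr_of1 fi1) /schreier !mulg1 repr_of1 //.
by rewrite invg1 mul1g.
Qed.

(** By [hom_eq_schreier], a homomorphism is determined by its values on the finite list of Schreier
    elements built from generators and coset representatives. *)
Lemma finite_perm_homs (fgG : finitely_generated G) (X : finType)
  (Omega : {group {perm X}}) : finite_set [set: perm_hom H Omega].
Proof.
have [s gen] := fgG.
have /finite_seqP[T TE] : finite_set (range repr_of).
  have -> : range repr_of = coset_repr @` range (left_coset H).
    by rewrite image_comp.
  exact/finite_image/fi_index.
pose U := [seq schreier x t | x <- s, t <- T].
pose code (phi : perm_hom H Omega) :=
  [ffun i : 'I_(size U) => phi (nth 1 U i)].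
rewrite -(preimage_setT code); apply: finite_preimage => [phi psi _ _ E|].
  apply: (hom_eq_schreier gen) => x t xs.
  have Tt : repr_of t \in T.
    by have : [set` T] (repr_of t) by rewrite -TE; exists t.
  have [i lt_i <-] : exists2 i, i < size U & nth 1 U i = schreier x (repr_of t).
    by apply/nthP; apply/allpairsP; exists (x, repr_of t).
  by move/ffunP: E => /(_ (Ordinal lt_i)); rewrite !ffunE.
exact: finite_finset.
Qed.

End FiniteHoms.

(* [fgG] is a phantom parameter that lets instance inference find finiteness. *)
Definition fin_perm_hom (G : groupType) (fgG : finitely_generated G)
  (H : fisubgroup G) (X : finType) (Omega : {group {perm X}}) : Type :=
  perm_hom H Omega.

Section FinPermHom.
Variables (G : groupType) (fgG : finitely_generated G) (H : fisubgroup G).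
Variables (X : finType) (Omega : {group {perm X}}).

Let homs := fset_set [set: perm_hom H Omega].

Let mem_homs (phi : perm_hom H Omega) : phi \in homs.
Proof. by rewrite in_fset_set ?inE //; apply: finite_perm_homs. Qed.

Let to_homs (phi : fin_perm_hom fgG H Omega) : homs := FSetSub (mem_homs phi).

Let to_homsK : cancel to_homs val. Proof. by []. Qed.

HB.instance Definition _ :=
  Finite.copy (fin_perm_hom fgG H Omega) (can_type to_homsK).

Lemma fsbig_perm_homs (R : Type) (idx : R) (op : Monoid.com_law idx)
    (F : perm_hom H Omega -> R) :
  \big[op/idx]_(phi \in [set: perm_hom H Omega]) F phi =
  \big[op/idx]_(phi : fin_perm_hom fgG H Omega) F phi.
Proof.
rewrite fsbig_finite; last exact: finite_perm_homs.
rewrite big_seq_fsetE /=.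
rewrite (reindex to_homs); first exact: eq_bigr.
by exists val => // phi _; apply: val_inj.
Qed.

End FinPermHom.

(** * Orbit representatives and transporters *)

Section OrbitReps.
Variables (G : groupType) (H : fisubgroup G) (X : finType).
Variables (Omega : {group {perm X}}).
Implicit Types phi : perm_hom H Omega.

Lemma hom_orbitP phi x y :
  reflect (exists2 g, fi_set H g & phi g x = y) (y \in orbit 'P (hom_image phi) x).
Proof.
apply: (iffP imsetP) => [[s]|[g Hg <-]].
  by rewrite inE => /asboolP[g Hg <-] ->; exists g.
by exists (phi g) => //; rewrite inE; apply/asboolP; exists g.
Qed.

(** Makes the value of a class function independent of the representative chosen in an orbit. *)
Lemma stab_conj phi g x : fi_set H g ->
  fi_conj (stab phi (phi g x)) g = stab phi x.
Proof.
move=> Hg; have [_ HM HV] := fi_subgroup H.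
apply: fisubgroup_ext; apply/funext => h /=; rewrite conj_setE /stab_set /=.
have hE : h ^ g^-1 = g * h * g^-1 by rewrite /conjg invgK mulgA.
apply/propext; split=> -[Hh xh].
  have Hh' : fi_set H h.
    by rewrite -(conjgKV g h) [_ ^ g]/conjg; apply: HM (HV _ Hg) (HM _ _ Hh Hg).
  split=> //; move: xh; rewrite hE !(hom_mul phi) ?homVK //; do ?exact: HM; do ?exact: HV.
  exact: perm_inj.
split; first by rewrite hE; apply: (HM); [exact: HM | exact: HV].
rewrite hE !(hom_mul phi) ?homVK ?xh //; do ?exact: HM; exact: HV.
Qed.

(** The index type is left free so that dependent pairs can index the orbits on [X * Y]. *)
Definition orbit_reps phi (I : Type) (v : I -> X) : Prop :=
  (forall x, exists i, exists2 g, fi_set H g & phi g (v i) = x) /\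
  (forall g i j, fi_set H g -> phi g (v i) = v j -> i = j).

(** Sending [i] to the orbit of [v i] is a bijection onto the orbits, and [stab_conj] trades the
    picked representative for [v i]. *)
Lemma orbit_value_prod (R : comPzRingType) (Z : class_function G R) phi
    (I : finType) (v : I -> X) : orbit_reps phi v ->
  (\prod_(xi in hom_orbits phi) orbit_value Z phi xi =
   \prod_(i : I) Z (stab phi (v i)))%R.
Proof.
move=> [vsurj vinj]; have [H1 HM HV] := fi_subgroup H.
pose O x := orbit 'P (hom_image phi) x.
have O_refl x : x \in O x by apply/hom_orbitP; exists 1; rewrite ?hom1.
have O_in g x : fi_set H g -> O (phi g x) = O x.
  move=> Hg; apply/setP => y; apply/hom_orbitP/hom_orbitP => -[h Hh <-].
    by exists (h * g); [exact: HM | rewrite hom_mul].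
  exists (h * g^-1); first by apply: HM => //; apply: HV.
  by rewrite hom_mul ?homVK //; apply: HV.
have -> : hom_orbits phi = [set O (v i) | i in [set: I]]%SET.
  apply/setP => xi; apply/imsetP/imsetP => -[x _ ->].
    by have [i [g Hg <-]] := vsurj x; exists i; rewrite // -/(O _) O_in.
  by exists (v x).
rewrite big_imset => [|i j _ _ /= E]; last first.
  have /hom_orbitP[g Hg] : v j \in O (v i) by rewrite E.
  exact: vinj.
apply: eq_big => [i|i _]; rewrite ?inE // /orbit_value.
case: pickP => [x /hom_orbitP[g Hg <-]|/(_ (v i))]; last by rewrite O_refl.
by rewrite -(stab_conj phi (v i) Hg) cf_conj.
Qed.

Definition hom_orbit phi : finType := {xi : {set X} | xi \in hom_orbits phi}.

Lemma exists_hom_orbit_rep phi :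
  { v : hom_orbit phi -> X | orbit_reps phi v }.
Proof.
have /choice[v vP] (i : hom_orbit phi) :
    exists x, val i = orbit 'P (hom_image phi) x.
  by have /imsetP[x _ ->] := valP i; exists x.
exists v; split=> [x|g i j Hg gE].
  have O_x : orbit 'P (hom_image phi) x \in hom_orbits phi by apply: imset_f.
  exists (exist (fun xi => xi \in hom_orbits phi) _ O_x).
  apply/hom_orbitP; rewrite -vP /=; apply/hom_orbitP.
  by exists 1; [case: (fi_subgroup H) | rewrite hom1].
apply: val_inj; rewrite !vP -gE.
have [_ HM HV] := fi_subgroup H.
apply/setP => y; apply/hom_orbitP/hom_orbitP => -[h Hh <-].
  exists (h * g^-1); first by apply: HM => //; apply: HV.
  by rewrite hom_mul ?homVK //; apply: HV.
by exists (h * g); [exact: HM | rewrite hom_mul].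
Qed.

Definition hom_orbit_rep phi : hom_orbit phi -> X := sval (exists_hom_orbit_rep phi).

Lemma hom_orbit_repP phi : orbit_reps phi (@hom_orbit_rep phi).
Proof. exact: svalP (exists_hom_orbit_rep phi). Qed.

Lemma orbit_reps_section phi (I : Type) (v : I -> X) : orbit_reps phi v ->
  exists (r : X -> I) (t : X -> G),
   [/\ forall x, fi_set H (t x), forall x, phi (t x) (v (r x)) = x,
       forall g x, fi_set H g -> r (phi g x) = r x,
       forall i, r (v i) = i & forall i, t (v i) = 1].
Proof.
move=> [vsurj vinj]; have [H1 HM HV] := fi_subgroup H.
have /choice[rt rtP] x : exists p : I * G,
    [/\ fi_set H p.2, phi p.2 (v p.1) = x & forall i, v i = x -> p.2 = 1].
  (* Treating representatives separately forces their transporter to be 1; [pull_back_id] rests on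
     this normalisation. *)
  have [[i <-]|nx] := pselect (exists i, v i = x).
    by exists (i, 1); rewrite /= hom1.
  have [i [g Hg gx]] := vsurj x; exists (i, g); split=> // j vj.
  by case: nx; exists j.
exists (fun x => (rt x).1), (fun x => (rt x).2).
have r_eq g x i : fi_set H g -> phi g x = v i -> (rt x).1 = i.
  move=> Hg xg; have [Ht tx _] := rtP x.
  by apply: (vinj (g * (rt x).2)); [exact: HM | rewrite hom_mul // tx].
split=> [x|x|g x Hg|i|i] /=; try by case: (rtP x).
- have [Ht tx _] := rtP (phi g x).
  symmetry; apply: (r_eq ((rt (phi g x)).2^-1 * g)); first by apply: HM => //; apply: HV.
  by rewrite (hom_mul phi (HV _ Ht) Hg) -{2}tx homVK.
- by apply: (@r_eq 1); rewrite ?hom1.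
- by have [_ _ /(_ i erefl)] := rtP (v i).
Qed.

End OrbitReps.

(** * The order of the wreath product *)

Section WreathPerm.
Variables (X Y : finType) (X_gt0 : (0 < #|X|)%N).

(** A point of [X] is what makes [w] visible: on an empty [X * Y] all permutations coincide. *)
Lemma wreath_perm_inj (l l' : {ffun Y -> {perm X}}) (w w' : {perm Y}) :
  wreath_perm l w = wreath_perm l' w' -> l = l' /\ w = w'.
Proof.
move=> /permP E; have {}E x y : (l y x, w y) = (l' y x, w' y).
  by have := E (x, y); rewrite !permE.
split; first by apply/ffunP => y; apply/permP => x; case: (E x y).
by apply/permP => y; have /card_gt0P[x _] := X_gt0; case: (E x y).
Qed.

Lemma card_wreath (Omega1 : {group {perm X}}) (Omega2 : {group {perm Y}}) :
  #|wreath Omega1 Omega2| = (#|Omega1| ^ #|Y| * #|Omega2|)%N.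
Proof.
have -> : #|wreath Omega1 Omega2| =
    #|[set wreath_perm p.1 p.2 |
        p in finset.setX [set l in ffun_on (mem Omega1)] Omega2]%SET|.
  apply: eq_card => s; apply/imset2P/imsetP => [[l w lO wO ->]|[[l w]]].
    by exists (l, w); rewrite // inE /= inE lO.
  by rewrite inE /= inE => /andP[lO wO] ->; exists l w.
rewrite card_in_imset; last first.
  by move=> [l w] [l' w'] _ _ /= /wreath_perm_inj[-> ->].
by rewrite cardsX cardsE card_ffun_on.
Qed.

End WreathPerm.

(** * Projecting homomorphisms from the wreath product to [Omega2] *)

Definition hom_over (G : groupType) (H : fisubgroup G) (X Y : finType)
    (Omega : {group {perm X * Y}}) (Omega2 : {group {perm Y}})
    (psi : perm_hom H Omega2) (Phi : perm_hom H Omega) : Prop :=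
  forall g, fi_set H g -> forall p, (Phi g p).2 = psi g p.2.

Section Projection.
Variables (G : groupType) (H : fisubgroup G) (X Y : finType).
Variables (X_gt0 : (0 < #|X|)%N).
Variables (Omega1 : {group {perm X}}) (Omega2 : {group {perm Y}}).

(** Together with [exists_hom_over], this partitions the homomorphisms into the wreath product into
    fibres indexed by [psi]. *)
Lemma hom_over_inj (psi psi' : perm_hom H Omega2)
    (Phi : perm_hom H (wreath Omega1 Omega2)) :
  hom_over psi Phi -> hom_over psi' Phi -> psi = psi'.
Proof.
move=> psiP psiP'; apply: hom_ext => g.
have [Hg|nHg] := pselect (fi_set H g); last by rewrite !hom_out.
have /card_gt0P[x _] := X_gt0; apply/permP => y.
by rewrite -(psiP g Hg (x, y)) psiP'.
Qed.

Lemma wreath_hom_components (Phi : perm_hom H (wreath Omega1 Omega2)) :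
  exists (l : G -> Y -> {perm X}) (w : G -> {perm Y}), forall g, fi_set H g ->
    [/\ forall y, l g y \in Omega1, w g \in Omega2 &
        forall x y, Phi g (x, y) = (l g y x, w g y)].
Proof.
have /choice[lw lwP] g : exists lw : (Y -> {perm X}) * {perm Y}, fi_set H g ->
    [/\ forall y, lw.1 y \in Omega1, lw.2 \in Omega2 &
        forall x y, Phi g (x, y) = (lw.1 y x, lw.2 y)].
  have [Hg|nHg] := pselect (fi_set H g); last by exists (fun=> 1, 1).
  have /imset2P[l w /ffun_onP lO wO E] := hom_in Phi Hg.
  by exists (l : Y -> _, w) => _; split=> // x y; rewrite E permE.
by exists (fun g => (lw g).1), (fun g => (lw g).2).
Qed.

Lemma exists_hom_over (Phi : perm_hom H (wreath Omega1 Omega2)) :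
  exists psi : perm_hom H Omega2, hom_over psi Phi.
Proof.
have [l [w lwP]] := wreath_hom_components Phi.
have [_ HM _] := fi_subgroup H.
pose psi_fun g := if `[< fi_set H g >] then w g else 1.
have psiE g : fi_set H g -> psi_fun g = w g.
  by move=> Hg; rewrite /psi_fun asboolT.
have psi_in g : fi_set H g -> psi_fun g \in Omega2.
  by move=> Hg; rewrite psiE //; case: (lwP g Hg).
have psi_mul g h : fi_set H g -> fi_set H h ->
    forall y, psi_fun (g * h) y = psi_fun g (psi_fun h y).
  move=> Hg Hh y; have /card_gt0P[x _] := X_gt0; rewrite !psiE //; last exact: HM.
  have := hom_mul Phi Hg Hh (x, y).
  have [_ _ ->] := lwP _ (HM _ _ Hg Hh); have [_ _ ->] := lwP _ Hh.
  by have [_ _ ->] := lwP _ Hg; case.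
have psi_out g : ~ fi_set H g -> psi_fun g = 1.
  by move=> nHg; rewrite /psi_fun asboolF.
exists (PermHom psi_in psi_mul psi_out) => g Hg [x y] /=.
by rewrite psiE //; have [_ _ ->] := lwP g Hg.
Qed.

End Projection.

(** * Parametrising the fibre over a fixed [psi] *)

Section HomAssembly.
Variables (G : groupType) (H : fisubgroup G) (X Y : finType).
Variables (Omega1 : {group {perm X}}) (Omega2 : {group {perm Y}}).
Variables (psi : perm_hom H Omega2).
Variables (I : finType) (v : I -> Y) (r : Y -> I) (t : Y -> G).
Hypotheses (Ht : forall y, fi_set H (t y)) (tP : forall y, psi (t y) (v (r y)) = y).
Hypotheses (r_psi : forall g y, fi_set H g -> r (psi g y) = r y).
Hypotheses (r_v : forall i, r (v i) = i) (t_v : forall i, t (v i) = 1).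

Let H1 : fi_set H 1. Proof. by case: (fi_subgroup H). Qed.
Let HM x y : fi_set H x -> fi_set H y -> fi_set H (x * y).
Proof. by case: (fi_subgroup H) => _ + _; apply. Qed.
Let HV x : fi_set H x -> fi_set H x^-1.
Proof. by case: (fi_subgroup H) => _ _; apply. Qed.

(** The Schreier cocycle of the transporters: from [v (r y)] to [y], then along [g], then back to
    the representative. *)
Definition pull_back (g : G) (y : Y) : G := (t (psi g y))^-1 * g * t y.

Lemma pull_back_stab g y : fi_set H g ->
  fi_set (stab psi (v (r y))) (pull_back g y).
Proof.
move=> Hg; have Hg' : fi_set H ((t (psi g y))^-1 * g) by apply: HM => //; apply: HV.
split; first exact: HM.
rewrite (hom_mul psi Hg' (Ht y)) tP (hom_mul psi (HV (Ht _)) Hg).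
by rewrite -[X in psi _ X]tP homVK // r_psi.
Qed.

Lemma pull_backM g h y : fi_set H g -> fi_set H h ->
  pull_back (g * h) y = pull_back g (psi h y) * pull_back h y.
Proof.
by move=> Hg Hh; rewrite /pull_back (hom_mul psi Hg Hh) !mulgA mulgK.
Qed.

Lemma pull_back_t y : pull_back (t y) (v (r y)) = 1.
Proof. by rewrite /pull_back tP t_v mulg1 mulVg. Qed.

Lemma pull_back_id i k : psi k (v i) = v i -> pull_back k (v i) = k.
Proof. by move=> kv; rewrite /pull_back kv t_v invg1 mul1g mulg1. Qed.

Section Assemble.
Variables (phi : forall i, perm_hom (stab psi (v i)) Omega1).
Variables (mu : Y -> {perm X}) (mu_in : forall y, mu y \in Omega1).

(* [mu y] is the X-component of the value at [t y]; as [s * t] in {perm X} *)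
(* applies [s] first, the factors appear in the order in which they act.   *)
Definition assembly_base (g : G) : {ffun Y -> {perm X}} :=
  [ffun y => (mu y)^-1 * phi (r y) (pull_back g y) * mu (psi g y)].

Definition assembly_fun (g : G) : {perm X * Y} :=
  if `[< fi_set H g >] then wreath_perm (assembly_base g) (psi g) else 1.

Lemma assembly_funE g x y : fi_set H g -> assembly_fun g (x, y) =
  (mu (psi g y) (phi (r y) (pull_back g y) ((mu y)^-1 x)), psi g y).
Proof.
by move=> Hg; rewrite /assembly_fun asboolT // permE /wreath_fun /= ffunE !permM.
Qed.

Lemma assembly_in g : fi_set H g -> assembly_fun g \in wreath Omega1 Omega2.
Proof.
move=> Hg; rewrite /assembly_fun asboolT //; apply/imset2P.
exists (assembly_base g) (psi g) => //; last exact: hom_in.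
apply/ffun_onP => y; rewrite ffunE; do 2?[apply: groupM]; rewrite ?groupV //.
exact/hom_in/pull_back_stab.
Qed.

Lemma assembly_mul g h : fi_set H g -> fi_set H h ->
  forall p, assembly_fun (g * h) p = assembly_fun g (assembly_fun h p).
Proof.
move=> Hg Hh [x y]; rewrite !assembly_funE //; last exact: HM.
rewrite (hom_mul psi Hg Hh) permK pull_backM //.
have Sg := pull_back_stab (psi h y) Hg; rewrite r_psi // in Sg *.
by rewrite (hom_mul (phi (r y)) Sg (pull_back_stab y Hh)).
Qed.

Lemma assembly_out g : ~ fi_set H g -> assembly_fun g = 1.
Proof. by move=> nHg; rewrite /assembly_fun asboolF. Qed.

(** An induced homomorphism in monomial form; [mu y] serves as a change of coordinates on the copy
    of [X] over [y]. *)
Definition assembly : perm_hom H (wreath Omega1 Omega2) :=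
  PermHom assembly_in assembly_mul assembly_out.

Lemma hom_over_assembly : hom_over psi assembly.
Proof. by move=> g Hg [x y] /=; rewrite assembly_funE. Qed.

Hypothesis mu_v : forall i, mu (v i) = 1.

(** Reads [mu] off the assembled homomorphism, as [assembly_stab] does for [phi]; injectivity of the
    parametrisation follows. *)
Lemma assembly_t x y : assembly (t y) (x, v (r y)) = (mu y x, y).
Proof.
by rewrite /= assembly_funE // pull_back_t tP mu_v invg1 perm1 hom1.
Qed.

Lemma assembly_stab i k x : fi_set (stab psi (v i)) k ->
  assembly k (x, v i) = (phi i k x, v i).
Proof.
move=> [Hk kv]; rewrite /= assembly_funE // kv pull_back_id // r_v.
by rewrite mu_v invg1 !perm1.
Qed.

Lemma stab_assembly i x : stab assembly (x, v i) = stab (phi i) x.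
Proof.
apply: fisubgroup_ext; apply/funext => k; apply/propext; split.
  move=> [Hk]; have [kv|nkv] := pselect (psi k (v i) = v i); last first.
    by rewrite /= assembly_funE // => -[].
  by rewrite assembly_stab // => -[].
by move=> [Sk kx]; split; [case: Sk | rewrite assembly_stab // kx].
Qed.

Lemma assembly_orbit_reps (J : I -> Type) (w : forall i, J i -> X) :
    (forall i, orbit_reps (phi i) (w i)) ->
  orbit_reps assembly
    (fun p : {i : I & J i} => (w (tag p) (tagged p), v (tag p))).
Proof.
move=> wP; split=> [[x y]|g [i j] [i' j'] /= Hg].
  have [wsurj _] := wP (r y).
  (* To reach [(x, y)], first move by [k] inside the copy of [X] over [v (r y)] to [(mu y)^-1 x],
     then transport by [t y]. *)
  have [j [k Sk kj]] := wsurj ((mu y)^-1 x); have [Hk _] := Sk.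
  exists (Tagged J j), (t y * k); first exact: HM.
  by rewrite (hom_mul assembly (Ht y) Hk) /= -[assembly_fun k]/(assembly k)
    assembly_stab // kj -[assembly_fun _]/(assembly (t y)) assembly_t permKV.
rewrite assembly_funE // => -[].
(* [r] is constant on [psi]-orbits, so the Y-coordinates give [i = i']; then [g] fixes [v i] and
   acts on [X] through [phi i]. *)
move=> + gv; have ii' : i = i' by rewrite -(r_v i) -(r_v i') -gv r_psi.
case: _ / ii' j' gv => j' gv.
rewrite gv mu_v invg1 !perm1 pull_back_id // r_v => gj.
by have [_ /(_ g j j') ->] := wP i.
Qed.

End Assemble.

Lemma assembly_inj (phi phi' : forall i, perm_hom (stab psi (v i)) Omega1)
    (mu mu' : Y -> {perm X}) (mu_in : forall y, mu y \in Omega1)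
    (mu'_in : forall y, mu' y \in Omega1) :
    (forall i, mu (v i) = 1) -> (forall i, mu' (v i) = 1) ->
    assembly phi mu_in = assembly phi' mu'_in ->
  (forall i, phi i = phi' i) /\ mu =1 mu'.
Proof.
move=> mu_v mu'_v E; split=> [i|y]; last first.
  apply/permP => x; have := assembly_t phi mu_in mu_v x y.
  by rewrite E assembly_t // => -[].
apply: hom_ext => k; have [Sk|nSk] := pselect (fi_set (stab psi (v i)) k).
  apply/permP => x; have := assembly_stab phi mu_in mu_v x Sk.
  by rewrite E assembly_stab // => -[].
by rewrite !hom_out.
Qed.

(** [phi i] is the action of the stabilizer of [v i] on the copy of [X] over [v i], and [mu y] is
    the X-component of [Phi (t y)] over [v (r y)]. *)
Lemma assembly_surj (Phi : perm_hom H (wreath Omega1 Omega2)) :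
    hom_over psi Phi ->
  exists (phi : forall i, perm_hom (stab psi (v i)) Omega1) (mu : Y -> {perm X})
    (mu_in : forall y, mu y \in Omega1),
    (forall i, mu (v i) = 1) /\ assembly phi mu_in = Phi.
Proof.
move=> PhiP; have [l [w lwP]] := wreath_hom_components Phi.
have PhiE g x y : fi_set H g -> Phi g (x, y) = (l g y x, psi g y).
  by move=> Hg; have := PhiP g Hg (x, y); have [_ _ ->] := lwP g Hg => /= ->.
have l_in g y : fi_set H g -> l g y \in Omega1.
  by move=> Hg; have [+ _ _] := lwP g Hg; apply.
have l_mul g h y x : fi_set H g -> fi_set H h ->
    l (g * h) y x = l g (psi h y) (l h y x).
  move=> Hg Hh; have := hom_mul Phi Hg Hh (x, y).
  by rewrite !PhiE //; [case | apply: HM].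
pose phi_fun i k := if `[< fi_set (stab psi (v i)) k >] then l k (v i) else 1.
have phiE i k : fi_set (stab psi (v i)) k -> phi_fun i k = l k (v i).
  by move=> Sk; rewrite /phi_fun asboolT.
have phi_in i k : fi_set (stab psi (v i)) k -> phi_fun i k \in Omega1.
  by move=> Sk; rewrite phiE //; case: Sk => Hk _; apply: l_in.
have phi_mul i g h : fi_set (stab psi (v i)) g -> fi_set (stab psi (v i)) h ->
    forall x, phi_fun i (g * h) x = phi_fun i g (phi_fun i h x).
  move=> Sg Sh x; have [_ SM _] := fi_subgroup (stab psi (v i)).
  rewrite !phiE //; last exact: SM.
  by case: Sg Sh => Hg _ [Hh hv]; rewrite l_mul // hv.
have phi_out i k : ~ fi_set (stab psi (v i)) k -> phi_fun i k = 1.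
  by move=> nSk; rewrite /phi_fun asboolF.
pose mu y := l (t y) (v (r y)).
have mu_in y : mu y \in Omega1 by apply: l_in.
exists (fun i => PermHom (phi_in i) (phi_mul i) (phi_out i)), mu, mu_in.
have l1 y x : l 1 y x = x by have := hom1 Phi (x, y); rewrite PhiE // => -[].
split=> [i|]; first by apply/permP => x; rewrite /mu t_v perm1 l1.
apply: hom_ext => g; have [Hg|nHg] := pselect (fi_set H g); last by rewrite !hom_out.
apply/permP => -[x y]; rewrite PhiE //= assembly_funE //=; congr pair.
have Sg := pull_back_stab y Hg; have [Hk kv] := Sg.
pose x' := (mu y)^-1 x.
(* Both sides are the X-component of one element acting on [x'] over [v (r y)], factored as
   [g * t y] and as [t (psi g y) * pull_back g y]. *)
have := l_mul _ _ (v (r y)) x' Hg (Ht y); rewrite tP -/(mu y) permKV => <-.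
rewrite phiE // {1}/mu r_psi // -/x'.
have := l_mul _ _ (v (r y)) x' (Ht (psi g y)) Hk; rewrite kv => <-.
by rewrite /pull_back !mulgA mulgV mul1g.
Qed.

End HomAssembly.

(** * Summing over one fibre *)

(** The index types must vary with [i], since each [i] will carry the homomorphisms out of its own
    stabilizer; a choice of summands is thus a dependent function. *)
Lemma big_distr_fprod (R : comPzSemiRingType) (I : finType) (T : I -> finType)
    (F : forall i, T i -> R) :
  (\prod_i \sum_(x : T i) F i x = \sum_(f : fprod T) \prod_i F i (f i))%R.
Proof.
transitivity (\sum_(f : fprod T) \prod_i [ffun x => F i x] (f i))%R.
  rewrite big_fprod -(bigA_distr_big_dep (fun i => tagged_with T i)
    (fun i => untag 0%R [ffun x => F i x])).
  apply: eq_bigr => i _; rewrite -[RHS](big_tag (fun i => [ffun x => F i x])).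
  by apply: eq_bigr => x _; rewrite ffunE.
by apply: eq_bigr => f _; apply: eq_bigr => i _; rewrite ffunE.
Qed.

Section Fibre.
Variables (G : groupType) (fgG : finitely_generated G) (R : comAlgType rat).
Variables (Z : class_function G R) (H : fisubgroup G) (X Y : finType).
Variables (Omega1 : {group {perm X}}) (Omega2 : {group {perm Y}}).
Variables (psi : perm_hom H Omega2) (I : finType) (v : I -> Y).

Lemma orbit_reps_inj : orbit_reps psi v -> injective v.
Proof.
move=> [_ vinj] i j E; apply: (vinj 1); last by rewrite hom1.
by case: (fi_subgroup H).
Qed.

(** [assembly] is a bijection from pairs (family [phi], normalised [mu]) onto the fibre, and the
    orbit product does not see [mu]; the multiplicity counts the maps [mu]. *)
Lemma sum_hom_over : orbit_reps psi v ->
  (\sum_(Phi : fin_perm_hom fgG H (wreath Omega1 Omega2) | `[< hom_over psi Phi >])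
     \prod_(xi in hom_orbits Phi) orbit_value Z Phi xi =
   (\prod_(i : I) \sum_(phi : fin_perm_hom fgG (stab psi (v i)) Omega1)
     \prod_(xi in hom_orbits phi) orbit_value Z phi xi)
     *+ (#|Omega1| ^ (#|Y| - #|I|)))%R.
Proof.
move=> vP; have [r [t [Ht tP r_psi r_v t_v]]] := orbit_reps_section vP.
pose T i : finType := fin_perm_hom fgG (stab psi (v i)) Omega1.
(* [M] consists of the maps supported off the representatives, hence trivial at each [v i]; values
   in [subg_of Omega1] build in membership. *)
pose D : pred Y := [pred y | y \notin codom v].
pose M := pffun_on (1 : subg_of Omega1) D predT.
have M_v (m : {ffun Y -> subg_of Omega1}) i : m \in M -> sgval (m (v i)) = 1.
  move=> /pffun_onP[/fintype.subsetP sD _].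
  have [->//|mv] := eqVneq (m (v i)) 1.
  by have := sD (v i) mv; rewrite !inE codom_f.
have card_M : #|M| = (#|Omega1| ^ (#|Y| - #|I|))%N.
  rewrite card_pffun_on; congr (_ ^ _)%N.
    by rewrite cardT -cardE card_sub; apply: eq_card => x; rewrite inE.
  by rewrite -(card_codom (orbit_reps_inj vP)) -(cardC (mem (codom v))) addKn.
pose asm (p : fprod T * {ffun Y -> subg_of Omega1}) :
    fin_perm_hom fgG H (wreath Omega1 Omega2) :=
  assembly Ht tP r_psi (fun i => p.1 i) (fun y => subgP (p.2 y)).
pose A := [pred p : fprod T * {ffun Y -> subg_of Omega1} | p.2 \in M].
have asm_inj : {in A &, injective asm}.
  move=> [f m] [f' m'] mM m'M /(assembly_inj r_v t_v) [i|i|Ef Em].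
  - exact: M_v.
  - exact: M_v.
  congr pair; first exact/fprodP.
  by apply/ffunP => y; apply/val_inj/Em.
have asm_im Phi : (Phi \in asm @: A)%SET = `[< hom_over psi Phi >].
  apply/imsetP/asboolP => [[p _ ->]|]; first exact: hom_over_assembly.
  move=> /(assembly_surj Ht tP r_psi t_v)[phi [mu [mu_in [mu_v <-]]]].
  pose m := [ffun y => subg Omega1 (mu y)].
  have mE y : sgval (m y) = mu y by rewrite ffunE subgK.
  exists ([fprod i => (phi i : T i)], m).
    apply/pffun_onP; split=> //; apply/fintype.subsetP => y my.
    apply/negP => /codomP[i yi]; case/eqP: my; apply: (can_inj sgvalK).
    by rewrite mE yi mu_v.
  rewrite /asm; apply: hom_ext => g /=; rewrite /assembly_fun.
  case: asboolP => // Hg; congr wreath_perm; apply/ffunP => y.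
  by rewrite !ffunE !subgK // fprodE.
rewrite -(eq_bigl _ _ asm_im) big_imset //=.
rewrite -(pair_big xpredT (mem M)
  (fun f m => \prod_(xi in hom_orbits (asm (f, m))) orbit_value Z (asm (f, m)) xi)%R) /=.
rewrite big_distr_fprod -sumrMnl; apply: eq_bigr => f _.
(* The multiplicity is turned back into a constant sum over [M], to be matched term by term. *)
rewrite -card_M -sumr_const; apply: eq_bigr => m mM.
have mv i : sgval (m (v i)) = 1 by exact: M_v.
rewrite (orbit_value_prod Z (assembly_orbit_reps Ht tP r_psi r_v t_v
  (fun y => subgP (m y)) mv (fun i => hom_orbit_repP (f i)))).
transitivity (\prod_i \prod_(j : hom_orbit (f i))
    Z (stab (f i) (hom_orbit_rep j)))%R; last first.
  by apply: eq_bigr => i _; rewrite (orbit_value_prod Z (hom_orbit_repP (f i))).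
rewrite sig_big_dep; apply: eq_bigr => -[i j] _ /=.
by rewrite stab_assembly.
Qed.

End Fibre.

(** * Comparing the two transforms *)

Theorem theorem1 (G : groupType) (fgG : finitely_generated G)
    (R : comAlgType rat) (Z : class_function G R)
    (X Y : finType) (X_gt0 : (0 < #|X|)%N)
    (Omega1 : {group {perm X}}) (Omega2 : {group {perm Y}}) :
  orbifold (orbifold Z Omega1) Omega2 = orbifold Z (wreath Omega1 Omega2).
Proof.
apply: class_function_ext => H; rewrite /= /orbifold_fun.
rewrite !(fsbig_perm_homs fgG) card_wreath // natrM invfM mulrC -scalerA.
congr (_ *: _)%R; rewrite scaler_sumr.
(* The sum over [Phi] is grouped by projection; after exchanging the sums, each [Phi] meets exactly
   one [psi]. *)
transitivity (\sum_(psi : fin_perm_hom fgG H Omega2)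
  \sum_(Phi : fin_perm_hom fgG H (wreath Omega1 Omega2) | `[< hom_over psi Phi >])
    ((#|Omega1| ^ #|Y|)%:R^-1 : rat) *:
      \prod_(xi in hom_orbits Phi) orbit_value Z Phi xi)%R; last first.
  rewrite (exchange_big_dep xpredT) //=; apply: eq_bigr => Phi _.
  have [psi psiP] := exists_hom_over X_gt0 Phi.
  rewrite (big_pred1 (psi : fin_perm_hom fgG H Omega2)) // => psi'.
  apply/asboolP/eqP => [|->//].
  by move/hom_over_inj; apply.
apply: eq_bigr => psi _; have vP := hom_orbit_repP psi.
rewrite -scaler_sumr (sum_hom_over fgG Z Omega1 vP).
rewrite (orbit_value_prod (orbifold Z Omega1) vP) /= /orbifold_fun.
under eq_bigr do rewrite (fsbig_perm_homs fgG).
rewrite scaler_prodl -scaler_nat scalerA; congr (_ *: _)%R.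
have O1 : (#|Omega1|%:R : rat) != 0%R by rewrite pnatr_eq0 -lt0n cardG_gt0.
(* The subtraction in the exponent is truncated, so this bound is needed to split [#|Omega1| ^ #|Y|]
   and cancel the multiplicity of the fibre. *)
have leIY : (#|hom_orbit psi| <= #|Y|)%N := leq_card _ (orbit_reps_inj vP).
have -> : (#|Omega1| ^ #|Y| = #|Omega1| ^ #|hom_orbit psi| *
    #|Omega1| ^ (#|Y| - #|hom_orbit psi|))%N by rewrite -expnD subnKC.
by rewrite exprVn natrM invfM -mulrA mulVf ?mulr1 natrX ?expf_neq0.
Qed.
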